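(* Let $(A, H, \triangleright, \triangleleft)$ be a matched pair of groups and $r : H \to A$ a deformation map. The following hold: (1) Let $H_r := H$, as a set, with the new multiplication $\bullet$ on $H$ defined for any $h, g \in H$ by $$h \bullet g := (h \triangleleft r(g))\, g .$$ Then $(H_r, \bullet)$ is a group, called the $r$-deformation of $H$. (2) The map $$\triangleright^r : H_r \times A \to A, \qquad h \triangleright^r a := r(h)\,(h \triangleright a)\, r(h \triangleleft a)^{-1}$$ for all $h \in H_r$, $a \in A$, is a left action of the group $H_r$ on the set $A$, and $(A, H_r, \triangleright^r, \triangleleft)$ is a matched pair of groups. Furthermore, the map $$\psi : A \bowtie^r H_r \to A \bowtie H, \qquad \psi(a, h) = (a\, r(h),\, h)$$ for all $a \in A$ and $h \in H$, is an isomorphism of groups, where $A \bowtie^r H_r$ is the bicrossed product associated to the matched pair $(A, H_r, \triangleright^r, \triangleleft)$. (3) $H_r$ is an $A$-complement of $A \bowtie H$.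
   Context: Matched pair: a matched pair of groups is a quadruple $(A, H, \triangleright, \triangleleft)$ where $A$, $H$ are groups, $\triangleright : H \times A \to A$ is a left action of the group $H$ on the set $A$, and $\triangleleft : H \times A \to H$ is a right action of the group $A$ on the set $H$, such that for all $a, b \in A$ and $h, g \in H$: $$h \triangleright (ab) = (h \triangleright a)\,((h \triangleleft a) \triangleright b), \qquad (hg) \triangleleft a = (h \triangleleft (g \triangleright a))\,(g \triangleleft a).$$ Bicrossed product: for a matched pair $(A, H, \triangleright, \triangleleft)$, the bicrossed product $A \bowtie H$ is the set $A \times H$ with the group structure $(a, h)\cdot(b, g) := (a (h \triangleright b),\, (h \triangleleft b) g)$ and unit $(1,1)$. $A$ and $H$ are viewed as subgroups of $A \bowtie H$ via the identifications $A \cong A \times \{1\}$, $H \cong \{1\} \times H$. Deformation map: a deformation map of the matched pair $(A, H, \triangleright, \triangleleft)$ is a function $r : H \to A$ with $r(1) = 1$ and, for all $g, h \in H$, $$r\bigl((h \triangleleft r(g))\, g\bigr) = r(h)\,(h \triangleright r(g)).$$ Complement: for a subgroup $A \leq G$, an $A$-complement of $G$ is a subgroup $K \leq G$ with $G = AK$ and $A \cap K = \{1\}$. *)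

(* Defs.v *)
From HB Require Import structures.
From mathcomp Require Import all_boot boolp classical_sets.

Set Implicit Arguments.
Unset Strict Implicit.
Unset Printing Implicit Defensive.

Local Open Scope classical_set_scope.
Local Open Scope group_scope.

Definition left_action (G : groupType) (X : Type) (act : G -> X -> X) : Prop :=
  (forall x, act 1 x = x) /\
  (forall g h x, act (g * h) x = act g (act h x)).

Definition right_action (G : groupType) (X : Type) (act : X -> G -> X) : Prop :=
  (forall x, act x 1 = x) /\
  (forall x g h, act x (g * h) = act (act x g) h).

Record matched_pair (A H : groupType)
    (lact : H -> A -> A) (ract : H -> A -> H) : Prop := MatchedPair {
  matched_pair_lact : left_action lact;
  matched_pair_ract : right_action ract;
  matched_pair_lactM : forall (h : H) (a b : A),
    lact h (a * b) = lact h a * lact (ract h a) b;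
  matched_pair_ractM : forall (h g : H) (a : A),
    ract (h * g) a = ract h (lact g a) * ract g a
}.

(* The carrier is A * H, but the group law below is not that of the direct
   product, which MathComp already attaches to pairs; hence the alias. *)
Definition bicrossed (A H : groupType) (lact : H -> A -> A)
  (ract : H -> A -> H) (mp : matched_pair lact ract) : Type := (A * H)%type.

Section BicrossedGroup.
Variables (A H : groupType) (lact : H -> A -> A) (ract : H -> A -> H).
Variable mp : matched_pair lact ract.

HB.instance Definition _ := Choice.on (bicrossed mp).

Definition bicrossed_mul (x y : bicrossed mp) : bicrossed mp :=
  (x.1 * lact x.2 y.1, ract x.2 y.1 * y.2).

Definition bicrossed_one : bicrossed mp := (1, 1).

Definition bicrossed_inv (x : bicrossed mp) : bicrossed mp :=
  (lact x.2^-1 x.1^-1, ract x.2^-1 x.1^-1).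

Lemma matched_pair_lact1 h : lact h 1 = 1.
Proof.
have := matched_pair_lactM mp h 1 1.
rewrite mulg1 (proj1 (matched_pair_ract mp)) => e; apply: (mulgI (lact h 1)).
by rewrite mulg1 -e.
Qed.

Lemma matched_pair_ract1 a : ract 1 a = 1.
Proof.
have := matched_pair_ractM mp 1 1 a.
rewrite mulg1 (proj1 (matched_pair_lact mp)) => e; apply: (mulgI (ract 1 a)).
by rewrite mulg1 -e.
Qed.

Lemma bicrossed_mulA : associative bicrossed_mul.
Proof.
move=> [a h] [b g] [c k]; rewrite /bicrossed_mul /=.
rewrite (matched_pair_lactM mp) (matched_pair_ractM mp).
by rewrite (proj2 (matched_pair_lact mp)) (proj2 (matched_pair_ract mp)) !mulgA.
Qed.

Lemma bicrossed_mul1 : left_id bicrossed_one bicrossed_mul.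
Proof.
move=> [a h]; rewrite /bicrossed_mul /=.
by rewrite (proj1 (matched_pair_lact mp)) matched_pair_ract1 !mul1g.
Qed.

Lemma bicrossed_mulr1 : right_id bicrossed_one bicrossed_mul.
Proof.
move=> [a h]; rewrite /bicrossed_mul /=.
by rewrite (proj1 (matched_pair_ract mp)) matched_pair_lact1 !mulg1.
Qed.

Lemma bicrossed_mulV : left_inverse bicrossed_one bicrossed_inv bicrossed_mul.
Proof.
move=> [a h]; rewrite /bicrossed_mul /bicrossed_inv /=; congr pair.
  by rewrite -(matched_pair_lactM mp) mulVg matched_pair_lact1.
rewrite -(proj2 (matched_pair_ract mp)) mulVg (proj1 (matched_pair_ract mp)).
by rewrite mulVg.
Qed.

Lemma bicrossed_mulVr : right_inverse bicrossed_one bicrossed_inv bicrossed_mul.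
Proof.
move=> [a h]; rewrite /bicrossed_mul /bicrossed_inv /=; congr pair.
  rewrite -(proj2 (matched_pair_lact mp)) mulgV (proj1 (matched_pair_lact mp)).
  by rewrite mulgV.
by rewrite -(matched_pair_ractM mp) mulgV matched_pair_ract1.
Qed.

HB.instance Definition _ := isGroup.Build (bicrossed mp)
  bicrossed_mulA bicrossed_mul1 bicrossed_mulr1 bicrossed_mulV bicrossed_mulVr.

Definition bicrossed_inA (a : A) : bicrossed mp := (a, 1).

End BicrossedGroup.

Arguments bicrossed_inA {A H lact ract} mp a.

Definition deformation_map (A H : groupType) (lact : H -> A -> A)
    (ract : H -> A -> H) (r : H -> A) : Prop :=
  r 1 = 1 /\
  (forall g h : H, r (ract h (r g) * g) = r h * lact h (r g)).

Definition deformed_mul (A H : groupType) (ract : H -> A -> H) (r : H -> A)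
    (h g : H) : H :=
  ract h (r g) * g.

Definition deformed_lact (A H : groupType) (lact : H -> A -> A)
    (ract : H -> A -> H) (r : H -> A) (h : H) (a : A) : A :=
  r h * lact h a * (r (ract h a))^-1.

Definition group_isomorphism (G K : groupType) (f : G -> K) : Prop :=
  bijective f /\ monoid_morphism f.

Definition subgroup (G : groupType) (K : set G) : Prop := group_closed (mem K).

Definition complement (G : groupType) (A K : set G) : Prop :=
  [/\ subgroup A, subgroup K,
      [set a * k | a in A & k in K] = [set: G] &
      A `&` K = [set 1]].

(* Main.v *)
Require Import Defs.
From HB Require Import structures.
From mathcomp Require Import all_boot boolp classical_sets.

Local Open Scope classical_set_scope.
Local Open Scope group_scope.

(** Everything happens inside the group [A ⋈ H].  The condition on a
    deformation map [r] says exactly that its graph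
    [Gamma = { (r h, h) | h in H }] contains the unit and is multiplied as [H]
    is by [•] ([deformation_graphM]); since [h |-> (r h, h)] is injective, the monoid laws
    for [•] are those of [A ⋈ H].  The [H]-component of [(r h, h)^-1] is a left
    inverse of [h], so [(H, •)] is a group isomorphic to [Gamma].

    Moreover [(a, 1) (r h, h) = (a r(h), h)], so every element of [A ⋈ H] is
    uniquely a product of an element of [A] and one of [Gamma]: [Gamma] is a
    complement of [A].  Like any such factorisation of a group it comes with a
    matched pair, read off by exchanging the factors of [(r h, h) (a, 1)], and
    the exchange law ([deformation_graph_exchange]) shows that its two actions
    are the deformed left action and the original right action.  The matched
    pair axioms then come from refactorising triple products [Gamma Gamma A] and
    [Gamma A A] in the two possible ways, and [psi], being the multiplication
    map [A x Gamma -> A ⋈ H], is an isomorphism. *)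

Lemma morphism_range_subgroup (G K : groupType) (f : G -> K) :
  monoid_morphism f -> subgroup (range f).
Proof.
move=> [f1 fM]; split; first by apply: mem_set; exists 1.
move=> _ _ /set_mem[x _ <-] /set_mem[y _ <-]; apply: mem_set; exists (x / y) => //.
by apply: (mulIg (f y)); rewrite -fM !divgK.
Qed.

Section Deformation.
Variables (A H : groupType) (lact : H -> A -> A) (ract : H -> A -> H).
Variable mp : matched_pair lact ract.

Lemma bicrossedM (x y : bicrossed mp) :
  x * y = (x.1 * lact x.2 y.1, ract x.2 y.1 * y.2).
Proof. by []. Qed.

Lemma bicrossed_inA_morphism : monoid_morphism (bicrossed_inA mp).
Proof.
split; [by [] | move=> a b]; rewrite bicrossedM /= (matched_pair_ract1 mp).
by rewrite (matched_pair_lact mp).1 mulg1.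
Qed.

Variable r : H -> A.
Hypothesis r_def : deformation_map lact ract r.

Local Notation inA := (bicrossed_inA mp).

Definition deformation_graph (h : H) : bicrossed mp := (r h, h).

Local Notation graph := deformation_graph.

Lemma deformation_graph_inj : injective graph.
Proof. by move=> h g []. Qed.

Lemma deformation_graph1 : graph 1 = 1.
Proof. by rewrite /graph r_def.1. Qed.

(** The defining identity of a deformation map, read in the bicrossed product:
    the graph is closed under multiplication. *)
Lemma deformation_graphM (h g : H) :
  graph (deformed_mul ract r h g) = graph h * graph g.
Proof. by rewrite bicrossedM /= -r_def.2. Qed.

Lemma inA_mul_graph (a : A) (h : H) : inA a * graph h = (a * r h, h).
Proof.
by rewrite bicrossedM /= (matched_pair_lact mp).1 (matched_pair_ract1 mp) mul1g.
Qed.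

Lemma inA_mul_graph_inj (a b : A) (h g : H) :
  inA a * graph h = inA b * graph g -> a = b /\ h = g.
Proof.
rewrite !inA_mul_graph => -[e hg]; split=> //.
by apply: (mulIg (r h)); rewrite e hg.
Qed.

(** Associativity is inherited from the bicrossed product, where the graph
    embeds. *)
Lemma deformed_mulA : associative (deformed_mul ract r).
Proof.
by move=> h g k; apply: deformation_graph_inj; rewrite !deformation_graphM mulgA.
Qed.

Lemma deformed_mul1 : left_id 1 (deformed_mul ract r).
Proof.
move=> h; apply: deformation_graph_inj.
by rewrite deformation_graphM deformation_graph1 mul1g.
Qed.

Lemma deformed_mulr1 : right_id 1 (deformed_mul ract r).
Proof.
move=> h; apply: deformation_graph_inj.
by rewrite deformation_graphM deformation_graph1 mulg1.
Qed.

(** The [H]-component of the inverse of [(r h, h)] in the bicrossed product. *)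
Definition deformed_inv (h : H) : H := ract h^-1 (r h)^-1.

Lemma deformed_mulV : left_inverse 1 deformed_inv (deformed_mul ract r).
Proof.
move=> h; rewrite /deformed_mul /deformed_inv -(matched_pair_ract mp).2 mulVg.
by rewrite (matched_pair_ract mp).1 mulVg.
Qed.

(** In the ambient group a left inverse is also a right inverse. *)
Lemma deformed_mulVr : right_inverse 1 deformed_inv (deformed_mul ract r).
Proof.
move=> h; apply: deformation_graph_inj.
rewrite deformation_graphM deformation_graph1.
have /eqP := deformation_graphM (deformed_inv h) h.
rewrite deformed_mulV deformation_graph1 eq_sym => /eqP gV.
by apply: (mulgI (graph (deformed_inv h))); rewrite mulgA gV mul1g mulg1.
Qed.

(** An alias of [H], which already carries another group law; it depends on the
    deformation data because the new law does. *)
Definition deformation (_ : matched_pair lact ract)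
  (_ : deformation_map lact ract r) : Type := H.

Local Notation Hr := (deformation mp r_def).

HB.instance Definition _ := Choice.on Hr.

HB.instance Definition _ := isGroup.Build Hr
  deformed_mulA deformed_mul1 deformed_mulr1 deformed_mulV deformed_mulVr.

Lemma deformation_graph_morphism :
  monoid_morphism (graph : Hr -> bicrossed mp).
Proof. by split; [exact: deformation_graph1 | exact: deformation_graphM]. Qed.

Local Notation lact_r := (deformed_lact lact ract r).

(** The factor [r (ract h a)^-1] in the deformed left action is what turns
    [(r h, h) (a, 1) = (r h * lact h a, ract h a)] into an element of [A] times
    an element of the graph. *)
Lemma deformation_graph_exchange (h : H) (a : A) :
  graph h * inA a = inA (lact_r h a) * graph (ract h a).
Proof. by rewrite inA_mul_graph bicrossedM /= mulg1 mulgVK. Qed.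

(** Moving [a] leftwards past the product [graph h * graph g] in one step, or
    past [graph g] and then [graph h], gives two factorisations of the same
    element; comparing them yields one axiom on each action. *)
Lemma graph_mul_exchange (h g : Hr) (a : A) :
  lact_r (h * g) a = lact_r h (lact_r g a) /\
  ract (h * g) a = (ract h (lact_r g a) : Hr) * ract g a.
Proof.
apply: inA_mul_graph_inj.
rewrite -deformation_graph_exchange !deformation_graphM.
by rewrite -mulgA deformation_graph_exchange !mulgA deformation_graph_exchange.
Qed.

(** The mirror image: [a] and [b] move past [graph h] together or in turn. *)
Lemma graph_exchange_mul (h : H) (a b : A) :
  lact_r h (a * b) = lact_r h a * lact_r (ract h a) b /\
  ract h (a * b) = ract (ract h a) b.
Proof.
apply: inA_mul_graph_inj.
rewrite -deformation_graph_exchange bicrossed_inA_morphism.2.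
rewrite (bicrossed_inA_morphism.2 (lact_r h a)).
by rewrite mulgA deformation_graph_exchange -!mulgA deformation_graph_exchange.
Qed.

Lemma deformed_left_action : left_action (G := Hr) lact_r.
Proof.
split=> [a | h g a]; last exact: (graph_mul_exchange h g a).1.
have := deformation_graph_exchange 1 a.
(* The left side [inA a] gets the graph factor [graph 1 = 1]. *)
rewrite deformation_graph1 mul1g -[LHS]mulg1 -deformation_graph1.
by move=> /inA_mul_graph_inj[].
Qed.

Lemma deformed_matched_pair : matched_pair (H := Hr) lact_r ract.
Proof.
split.
- exact: deformed_left_action.
- exact: matched_pair_ract mp.
- by move=> h a b; case: (graph_exchange_mul h a b).
- by move=> h g a; case: (graph_mul_exchange h g a).
Qed.

Definition deformation_iso (x : bicrossed deformed_matched_pair) :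
  bicrossed mp := (x.1 * r x.2, x.2).

(** In a product [a h b g] with [h], [g] in the graph, exchanging [h] and [b]
    gives the multiplication of the deformed bicrossed product. *)
Lemma deformation_iso_isomorphism : group_isomorphism deformation_iso.
Proof.
split.
  exists (fun x : bicrossed mp => (x.1 * (r x.2)^-1, x.2)) => -[a h] /=.
    by rewrite /deformation_iso /= mulgK.
  by rewrite /deformation_iso /= mulgVK.
split; first by rewrite /deformation_iso /= r_def.1 mulg1.
move=> [a h] [b g]; rewrite /deformation_iso /= -!inA_mul_graph.
rewrite bicrossed_inA_morphism.2 deformation_graphM !mulgA; congr (_ * _).
by rewrite -!mulgA -deformation_graph_exchange.
Qed.

Lemma deformation_graph_complement : complement (range inA) (range graph).
Proof.
split.
- exact: morphism_range_subgroup bicrossed_inA_morphism.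
- exact: (@morphism_range_subgroup Hr _ _ deformation_graph_morphism).
- apply/seteqP; split=> // -[a h] _.
  exists (inA (a * (r h)^-1)); first by exists (a * (r h)^-1).
  by exists (graph h); [exists h | rewrite inA_mul_graph mulgVK].
- apply/seteqP; split=> [_ [[a _ <-] [h _ [+ h1]]] | _ ->].
    by rewrite h1 r_def.1 => <-.
  by split; exists 1 => //; exact: deformation_graph1.
Qed.

Lemma deformation_iso1 : (fun h => deformation_iso (1, h)) = graph.
Proof. by apply/funext => h; rewrite /deformation_iso /= mul1g. Qed.

End Deformation.

Theorem theorem2p4 (A H : groupType) (lact : H -> A -> A) (ract : H -> A -> H)
    (mp : matched_pair lact ract) (r : H -> A)
    (r_def : deformation_map lact ract r) :
  exists Hr_group : Group.axioms_ H,
    let Hr : groupType := Group.Pack Hr_group in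
    (forall h g : Hr, h * g = deformed_mul ract r h g) /\
    left_action (G := Hr) (deformed_lact lact ract r) /\
    exists mpr : matched_pair (H := Hr) (deformed_lact lact ract r) ract,
      let psi : bicrossed mpr -> bicrossed mp := fun x => (x.1 * r x.2, x.2) in
      let incl : Hr -> bicrossed mp := fun h => psi (1, h) in
      group_isomorphism psi /\
      (injective incl /\ monoid_morphism incl) /\
      complement (range (bicrossed_inA mp)) (range incl).
Proof.
exists (Group.on (deformation _ _ _ _ _ mp r_def)) => Hr; split=> //.
split; first exact: deformed_left_action.
exists (deformed_matched_pair _ _ _ _ mp _ r_def) => psi incl.
have -> : incl = deformation_graph _ _ _ _ mp r.
  exact: deformation_iso1.
split; first exact: deformation_iso_isomorphism.
split; last exact: deformation_graph_complement.
by split; [exact: deformation_graph_inj | exact: deformation_graph_morphism].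
Qed.
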